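(* Let $N\ge1$ be odd. Then the coefficients of the extremal polynomial $\sum_{k=1}^N\alpha_kz^k$ of the problem $$\hat J_N=\max\Bigl\{\sum_{j=1}^N\alpha_j:\ \alpha_1=1,\ \sum_{j=1}^N\alpha_j\sin jt\ge0\ \text{for all } t\in[0,\pi]\Bigr\}$$ are given by $$\alpha_k=\frac{(-1)^{k-1}}{U'_N\left(\sin\frac{\pi}{2(N+2)}\right)}\,U'_{N-k+1}\left(\sin\frac{\pi}{2(N+2)}\right)U_{k-1}\left(\sin\frac{\pi}{2(N+2)}\right),\qquad k=1,\ldots,N.$$
   Context: $U_j$ is the Chebyshev polynomial of the second kind, $U_j(\cos t)=\frac{\sin (j+1)t}{\sin t}$; $U_j'$ denotes its derivative. The maximum in $\hat J_N$ is over real coefficients $\alpha_1=1,\alpha_2,\ldots,\alpha_N$; the extremal polynomial is the polynomial $\sum_{j=1}^N\alpha_jz^j$ with admissible coefficients attaining the maximum. *)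

(* Defs.v *)
From mathcomp Require Import all_boot all_order all_algebra.
From mathcomp Require Import reals trigo.
From mathcomp Require Import ring.

Set Implicit Arguments.
Unset Strict Implicit.
Unset Printing Implicit Defensive.

Import Order.TTheory GRing.Theory Num.Theory.
Local Open Scope ring_scope.

(* Only a 1, ..., a N are meaningful; the other values of a are ignored. *)
Definition sine_poly (R : realType) (N : nat) (a : nat -> R) (t : R) : R :=
  \sum_(1 <= j < N.+1) a j * sin (j%:R * t).

Definition admissible (R : realType) (N : nat) (a : nat -> R) : Prop :=
  a 1%N = 1 /\ forall t : R, 0 <= t <= pi -> 0 <= sine_poly N a t.

Definition coef_sum (R : realType) (N : nat) (a : nat -> R) : R :=
  \sum_(1 <= j < N.+1) a j.

Definition attains_max (R : realType) (N : nat) (a : nat -> R) : Prop :=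
  admissible N a /\
  forall b : nat -> R, admissible N b -> coef_sum N b <= coef_sum N a.

Definition extremal_polynomial (R : realType) (N : nat) (p : {poly R}) : Prop :=
  exists a : nat -> R,
    attains_max N a /\ p = \sum_(1 <= j < N.+1) a j *: 'X^j.

Fixpoint chebyshevU (R : realType) (j : nat) : {poly R} :=
  match j with
  | 0%N => 1
  | j'.+1 => match j' with
             | 0%N => 2%:R *: 'X
             | j''.+1 => 2%:R *: 'X * chebyshevU R j' - chebyshevU R j''
             end
  end.

Lemma chebyshevU_rec (R : realType) (j : nat) :
  chebyshevU R j.+2 = 2%:R *: 'X * chebyshevU R j.+1 - chebyshevU R j.
Proof. by []. Qed.

Lemma chebyshevU_cosM (R : realType) (j : nat) (t : R) :
  (chebyshevU R j).[cos t] * sin t = sin (j.+1%:R * t).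
Proof.
suff: (chebyshevU R j).[cos t] * sin t = sin (j.+1%:R * t) /\
      (chebyshevU R j.+1).[cos t] * sin t = sin (j.+2%:R * t) by case.
elim: j => [|j [IH1 IH2]].
  split; first by rewrite /= hornerC !mul1r.
  rewrite /= hornerZ hornerX -mulrA !mulr_natl !mulr2n sinD.
  by rewrite [cos t * _]mulrC.
split=> //; rewrite chebyshevU_rec hornerD hornerN hornerM hornerZ hornerX.
rewrite mulrBl IH1 -[_ * _ * sin t]mulrA IH2.
have -> : j.+3%:R * t = j.+2%:R * t + t by rewrite -[j.+3%:R]natr1 mulrDl mul1r.
have -> : j.+1%:R * t = j.+2%:R * t - t
  by rewrite -[j.+2%:R]natr1 mulrDl mul1r addrK.
rewrite !sinD cosN sinN; ring.
Qed.

(* The identity U_j(cos t) = sin((j+1)t) / sin t characterizes U_j. *)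
Lemma chebyshevUP (R : realType) (j : nat) (p : {poly R}) :
  p = chebyshevU R j <->
  forall t : R, sin t != 0 -> p.[cos t] = sin (j.+1%:R * t) / sin t.
Proof.
have UE (t : R) : sin t != 0 ->
    (chebyshevU R j).[cos t] = sin (j.+1%:R * t) / sin t.
  by move=> st; rewrite -chebyshevU_cosM mulfK.
split=> [-> // | pE].
apply/eqP; rewrite -subr_eq0; apply/negPn/negP => d0.
pose x (k : nat) : R := k.+2%:R^-1.
have x01 k : 0 < x k < 1.
  by rewrite invr_gt0 ltr0n /= invf_lt1 ?ltr0n // ltr1n.
pose rs := [seq x k | k <- iota 0 (size (p - chebyshevU R j))].
have urs : uniq rs.
  rewrite map_inj_uniq ?iota_uniq // => k l /invr_inj /eqP.
  by rewrite eqr_nat => /eqP [].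
have rrs : all (root (p - chebyshevU R j)) rs.
  apply/allP => _ /mapP [k _ ->]; have /andP [x0 x1] := x01 k.
  have xI : -1 <= x k <= 1 by rewrite (ltW x1) (le_trans _ (ltW x0)) ?oppr_le0.
  have st : sin (acos (x k)) != 0.
    by rewrite sin_acos // sqrtr_eq0 -ltNge subr_gt0 expr_lt1 // ltW.
  rewrite rootE hornerD hornerN -[x k]acosK ?in_itv //.
  by rewrite pE // UE // subrr.
by have := max_poly_roots d0 rrs urs; rewrite size_map size_iota ltnn.
Qed.

(* Main.v *)
(** For M = N + 2, sums over the odd multiples t_i of pi / M recover a_1 from
    S(t_i) sin t_i and a_1 + ... + a_N from S(t_i) sin t_i / (1 - cos t_i), where
    S is the sine polynomial.  As S sin >= 0 and cos t_i is largest at t_0, this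
    bounds the coefficient sum by 1 / (2 (1 - cos t_0)), and equality forces S to
    vanish, hence by nonnegativity to vanish doubly, at every node inside (0, pi)
    but t_0.  A Hermite-type discrete inversion formula then expresses all the
    a_k through S(t_0), S'(t_0) and S'(pi), and a_1 = 1, a_(N+1) = a_(N+2) = 0
    determine these three numbers.  The bound is attained by a multiple of
    sin t * prod (cos t - cos t_i)^2, so the a_k are also those of a maximizer;
    trigonometry at pi / 2 - t_0 / 2 turns them into Chebyshev values. *)

Require Import Defs.
From mathcomp Require Import all_boot all_order all_algebra.
From mathcomp Require Import reals trigo.
From mathcomp Require Import boolp functions normedtype derive realfun.
From mathcomp Require Import ring lra zify.

Set Implicit Arguments.
Unset Strict Implicit.
Unset Printing Implicit Defensive.

Import Order.TTheory GRing.Theory Num.Theory.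
Import numFieldNormedType.Exports.
Local Open Scope ring_scope.

(** * Discrete orthogonality and Hermite inversion at the nodes *)

Lemma sin_natpi (R : realType) (n : nat) : sin (n%:R * pi) = 0 :> R.
Proof.
by rewrite mulr_natl -[pi *+ n]add0r (alternatingn (@sinDpi R)) sin0 mulr0.
Qed.

Lemma cos_natpi (R : realType) (n : nat) : cos (n%:R * pi) = (-1) ^+ n :> R.
Proof.
by rewrite mulr_natl -[pi *+ n]add0r (alternatingn (@cosDpi R)) cos0 mulr1.
Qed.

(** For [i < M] these are the solutions of cos (M t) = -1 in (0, 2 pi); the full period makes the
    set symmetric about pi. *)
Definition node (R : realType) (M i : nat) : R := i.*2.+1%:R * (pi / M%:R).

(** With u = n pi / M, multiplication by 2 sin u telescopes the sum to sin (2 n pi) = 0. Below 2M,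
    sin u vanishes only for n = 0 and n = M, where all cosines equal 1 and -1 respectively. *)
Lemma sum_cos_node (R : realType) (M n : nat) : (0 < M)%N -> (n < M.*2)%N ->
  \sum_(i < M) cos (n%:R * node R M i) = M%:R * ((n == 0)%:R - (n == M)%:R).
Proof.
move=> M0 nM; have Mn0 : M%:R != 0 :> R by rewrite pnatr_eq0 -lt0n.
have [->|n0] := eqVneq n 0%N.
  rewrite (ltn_eqF M0) subr0 mulr1.
  under eq_bigr do rewrite mul0r cos0.
  by rewrite sumr_const card_ord.
have [->|nneM] := eqVneq n M.
  rewrite sub0r mulrN1.
  have cosM i : cos (M%:R * node R M i) = -1.
    rewrite /node mulrCA [M%:R * _]mulrC divfK // cos_natpi.
    by rewrite -signr_odd /= odd_double.
  under eq_bigr do rewrite cosM.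
  by rewrite sumr_const card_ord mulNrn.
rewrite subrr mulr0; pose u := n%:R * (pi / M%:R) : R.
have u0 : sin u != 0.
  have M_gt0 : 0 < M%:R :> R by rewrite ltr0n.
  have uE : u = n%:R / M%:R * pi by rewrite /u; field.
  have [ltnM|leMn] := ltnP n M.
    rewrite gt_eqF // sin_gt0_pi // uE gtr_pMl ?pi_gt0 //.
    rewrite mulr_gt0 ?pi_gt0 ?divr_gt0 ?ltr0n ?(lt0n n) //=.
    by rewrite ltr_pdivrMr // mul1r ltr_nat.
  have ltMn : (M < n)%N by lia.
  rewrite -[u](subrK pi) sinDpi oppr_eq0 gt_eqF // sin_gt0_pi //.
  have -> : u - pi = (n - M)%:R / M%:R * pi.
    by rewrite natrB 1?ltnW // uE; field.
  rewrite gtr_pMl ?pi_gt0 // mulr_gt0 ?pi_gt0 ?divr_gt0 ?ltr0n ?subn_gt0 //=.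
  by rewrite ltr_pdivrMr // mul1r ltr_nat; lia.
have telescope i : 2 * sin u * cos (n%:R * node R M i)
    = sin (2 * u * i.+1%:R) - sin (2 * u * i%:R).
  have -> : n%:R * node R M i = (2 * u * i%:R) + u.
    rewrite /node /u -[i.*2.+1]addn1 natrD -muln2 natrM; ring.
  have -> : 2 * u * i.+1%:R = (2 * u * i%:R + u) + u by rewrite -natr1; ring.
  set x := _ + u; have -> : 2 * u * i%:R = x - u by rewrite addrK.
  by rewrite sinB sinD; ring.
apply: (mulfI (mulf_neq0 (_ : 2 != 0 :> R) u0)); first by rewrite pnatr_eq0.
rewrite mulr0 big_distrr /=; under eq_bigr do rewrite telescope.
rewrite -(big_mkord xpredT
  (fun i => sin (2 * u * i.+1%:R) - sin (2 * u * i%:R))).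
rewrite telescope_sumr // mulr0 sin0 subr0.
have -> : 2 * u * M%:R = n.*2%:R * pi by rewrite /u -muln2 natrM; field.
exact: sin_natpi.
Qed.

Lemma sum_cos_subr_node (R : realType) (M j k : nat) :
  (j < k + M)%N -> (k < j + M)%N ->
  \sum_(i < M) cos (j%:R * node R M i - k%:R * node R M i)
    = M%:R * (j == k)%:R.
Proof.
wlog lejk : j k / (j <= k)%N => [wlog_le|] jk kj.
  have [/wlog_le->//|ltkj] := leqP j k.
  rewrite eq_sym -(wlog_le k j (ltnW ltkj) kj jk).
  by apply: eq_bigr => i _; rewrite -opprB cosN.
have subE i : cos (j%:R * node R M i - k%:R * node R M i)
    = cos ((k - j)%:R * node R M i).
  by rewrite -opprB cosN -mulrBl natrB.
under eq_bigr do rewrite subE.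
rewrite sum_cos_node; [|lia..].
have -> : (k - j == 0)%N = (j == k) by apply/eqP/eqP; lia.
by have -> : (k - j == M)%N = false; [apply/eqP; lia|rewrite subr0].
Qed.

(* Since j + k may reach M, the values and the slopes at the nodes each
   determine a_k only up to a_(M-k); the weights M - k and 1 cancel it. *)
Lemma hermite_kernel (R : realType) (N j k : nat) :
  (0 < j <= N)%N -> (0 < k <= N.+2)%N ->
  \sum_(i < N.+2) ((N.+2%:R - k%:R) * (sin (j%:R * node R N.+2 i)
                                       * sin (k%:R * node R N.+2 i))
                   + j%:R * (cos (j%:R * node R N.+2 i)
                             * cos (k%:R * node R N.+2 i)))
    = N.+2%:R ^+ 2 / 2 * (j == k)%:R.
Proof.
move=> /andP[j0 jN] /andP[k0 kN].
pose t i := node R N.+2 i; pose M : R := N.+2%:R.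
transitivity (\sum_(i < N.+2) ((M - k%:R + j%:R) / 2
    * cos (j%:R * t i - k%:R * t i)
    + (j%:R + k%:R - M) / 2 * cos ((j + k)%:R * t i))).
  apply: eq_bigr => i _.
  by rewrite natrD [(_ + _) * t _]mulrDl cosB cosD /t /M; field.
rewrite big_split -!big_distrr /= sum_cos_subr_node; [|lia..].
rewrite sum_cos_node; [|lia..].
have -> : (j + k == 0)%N = false by apply/eqP; lia.
rewrite sub0r; have [<-|_] := eqVneq j k.
  have [eM|_] := eqVneq (j + j)%N N.+2; last by rewrite /= /M; field.
  by rewrite /= /M -eM natrD; field.
have [eM|_] := eqVneq (j + k)%N N.+2; last by rewrite /=; ring.
by rewrite /= /M -eM natrD; field.
Qed.

Definition sine_deriv (R : realType) (N : nat) (a : nat -> R) (t : R) : R :=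
  \sum_(1 <= j < N.+1) a j * (j%:R * cos (j%:R * t)).

(** The kernel identity, multiplied by a_j and summed over j. The range of [k] exceeds [N] by two on
    purpose: the null coefficients there later serve as equations. *)
Lemma hermite_coef (R : realType) (N k : nat) (a : nat -> R) :
  (0 < k <= N.+2)%N ->
  N.+2%:R ^+ 2 / 2 * (if (k <= N)%N then a k else 0) =
  \sum_(i < N.+2) ((N.+2%:R - k%:R) * (sine_poly N a (node R N.+2 i)
                                       * sin (k%:R * node R N.+2 i))
                   + sine_deriv N a (node R N.+2 i)
                     * cos (k%:R * node R N.+2 i)).
Proof.
move=> kN; transitivity (\sum_(1 <= j < N.+1) a j *
    (N.+2%:R ^+ 2 / 2 * (j == k)%:R)).
  have [leN|ltN] := leqP k N.
    rewrite (bigD1_seq k) ?iota_uniq ?mem_index_iota //=; last lia.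
    rewrite eqxx mulr1 mulrC big1 ?addr0 // => j /negbTE->.
    by rewrite !mulr0.
  rewrite mulr0 big_nat big1 // => j jN.
  by have -> : (j == k) = false; [apply/eqP; lia|rewrite !mulr0].
transitivity (\sum_(1 <= j < N.+1) \sum_(i < N.+2)
   (a j * ((N.+2%:R - k%:R) * (sin (j%:R * node R N.+2 i)
                                       * sin (k%:R * node R N.+2 i))
                   + j%:R * (cos (j%:R * node R N.+2 i)
                             * cos (k%:R * node R N.+2 i))))).
  rewrite !big_nat; apply: eq_bigr => j jN.
  by rewrite -big_distrr /= hermite_kernel.
rewrite exchange_big; apply: eq_bigr => i _ /=.
rewrite /sine_poly /sine_deriv !big_distrl !big_distrr /= -big_split /=.
by apply: eq_bigr => j _; ring.
Qed.

(** * Symmetry and ordering of the nodes *)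

Lemma node_rev (R : realType) (M i : nat) : (i < M)%N ->
  node R M (M - i.+1) = pi *+ 2 - node R M i.
Proof.
move=> iM; have M0 : M%:R != 0 :> R by rewrite pnatr_eq0; lia.
rewrite /node -[_.+1 in LHS]addn1 -[i.*2.+1]addn1 !natrD -!muln2 !natrM natrB //.
by rewrite -[i.+1%:R]natr1 mulr2n; field.
Qed.

Lemma cosB2pi (R : realType) (t : R) : cos (pi *+ 2 - t) = cos t.
Proof. by rewrite addrC cosD2pi cosN. Qed.

Lemma sinB2pi (R : realType) (t : R) : sin (pi *+ 2 - t) = - sin t.
Proof. by rewrite addrC sinD2pi sinN. Qed.

Lemma node_itv (R : realType) (M i : nat) : (i < M)%N ->
  0 < node R M i < pi *+ 2.
Proof.
move=> iM; have M_gt0 : (0 < M)%N by lia.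
have M0 : 0 < M%:R :> R by rewrite ltr0n.
have -> : node R M i = i.*2.+1%:R / M%:R * pi by rewrite /node; field; lra.
rewrite mulr_gt0 ?divr_gt0 ?pi_gt0 ?ltr0n //=.
rewrite -[pi *+ 2]mulr_natl ltr_pM2r ?pi_gt0 // ltr_pdivrMr // -natrM ltr_nat; lia.
Qed.

(** Reflection about pi moves the node into [0, pi], where cosine decreases. The index [M.-1] is
    excluded as the mirror image of 0. *)
Lemma cos_node_lt (R : realType) (M i : nat) : (0 < i < M.-1)%N ->
  cos (node R M i) < cos (node R M 0).
Proof.
wlog leiM : i / (i.*2 < M)%N => [wlog_le|] iM.
  have [/wlog_le->//|ltMi] := ltnP i.*2 M.
  rewrite -cosB2pi -node_rev; [apply: wlog_le|]; lia.
have M0 : 0 < M%:R :> R by rewrite ltr0n; lia.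
have itv (k : nat) : (k.*2 < M)%N -> node R M k \in `[0, pi].
  move=> kM; have -> : node R M k = k.*2.+1%:R / M%:R * pi.
    by rewrite /node; field; lra.
  rewrite in_itv /= mulr_ge0 ?divr_ge0 ?pi_ge0 ?ler0n //=.
  by rewrite ger_pMl ?pi_gt0 // ler_pdivrMr // mul1r ler_nat.
rewrite ltr_cos ?itv //; last lia.
by rewrite /node ltr_pM2r ?divr_gt0 ?pi_gt0 // ltr_nat; lia.
Qed.

Lemma cos_node_le (R : realType) (M i : nat) : (i < M)%N ->
  cos (node R M i) <= cos (node R M 0).
Proof.
move=> iM; have [->//|i0] := eqVneq i 0%N.
have [ei|ne] := eqVneq i M.-1.
  have -> : i = (M - 1)%N by lia.
  by rewrite node_rev ?cosB2pi //; lia.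
by apply/ltW/cos_node_lt; lia.
Qed.

Lemma cos_node_lt1 (R : realType) (M i : nat) : (1 < M)%N -> (i < M)%N ->
  cos (node R M i) < 1.
Proof.
move=> M1 iM; apply: le_lt_trans (cos_node_le R iM) _.
have M0 : 0 < M%:R :> R by rewrite ltr0n; lia.
rewrite -cos0 ltr_cos ?in_itv /= ?lexx ?pi_ge0 // /node mul1r.
  by rewrite divr_gt0 ?pi_gt0.
rewrite divr_ge0 ?pi_ge0 ?ler0n //= ler_pdivrMr // ler_peMr ?pi_ge0 //.
by rewrite ler1n; lia.
Qed.

(** * The upper bound and its equality case *)

(** The weight sin t / (1 - cos t) is cot (t/2), and (sin (j+1)t - sin jt) cot (t/2) = cos jt + cos
    (j+1)t. These cosines sum to zero over the nodes, so the value does not depend on j; for j = 1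
    the summand is 1 + cos t. *)
Lemma sum_sin_cot_node (R : realType) (N j : nat) : (0 < j < N.+2)%N ->
  \sum_(i < N.+2) sin (j%:R * node R N.+2 i)
     * (sin (node R N.+2 i) / (1 - cos (node R N.+2 i))) = N.+2%:R.
Proof.
have cos_neq1 (i : 'I_N.+2) : 1 - cos (node R N.+2 i) != 0.
  by rewrite subr_eq0 gt_eqF // cos_node_lt1.
have sumcos n : (0 < n < N.+2)%N ->
    \sum_(i < N.+2) cos (n%:R * node R N.+2 i) = 0.
  move=> nN; rewrite sum_cos_node //; last lia.
  have /negbTE-> : n != 0%N by lia.
  have /negbTE-> : n != N.+2 by lia.
  by rewrite subrr mulr0.
elim: j => [//|j IHj] jN; have [->|j0] := posnP j.
  transitivity (\sum_(i < N.+2) (1 + cos (1%:R * node R N.+2 i))); last first.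
    by rewrite big_split /= sumcos // addr0 sumr_const card_ord.
  apply: eq_bigr => i _; rewrite mul1r mulrA -expr2 sin2cos2.
  by field.
transitivity (\sum_(i < N.+2) (sin (j%:R * node R N.+2 i)
     * (sin (node R N.+2 i) / (1 - cos (node R N.+2 i)))
     + cos (j%:R * node R N.+2 i) + cos (j.+1%:R * node R N.+2 i))); last first.
  by rewrite !big_split /= IHj ?sumcos ?addr0 //; lia.
apply: eq_bigr => i _.
set t := node R N.+2 i; have -> : j.+1%:R * t = j%:R * t + t.
  by rewrite -natr1; ring.
have ht := cos2Dsin2 t; have h0 := cos_neq1 i; rewrite -/t in h0.
rewrite sinD cosD; apply: (mulIf h0).
set u := cos t in ht h0 *; set v := sin t in ht *.
have hv : v * v = 1 - u * u by rewrite -!expr2; apply/eqP; lra.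
transitivity ((sin (j%:R * t) * u + cos (j%:R * t) * v) * v).
  by rewrite -mulrA divfK.
transitivity (sin (j%:R * t) * v
   + (cos (j%:R * t) + (cos (j%:R * t) * u - sin (j%:R * t) * v)) * (1 - u)).
  rewrite mulrDl -!mulrA hv; ring.
by field.
Qed.

(** By product-to-sum only the frequencies j - 1 and j + 1 occur. Since j + 1 <= N + 1 < N + 2, no
    aliasing arises and only j = 1 survives. *)
Lemma sum_sine_poly_sin (R : realType) (N : nat) (a : nat -> R) : (0 < N)%N ->
  \sum_(i < N.+2) sine_poly N a (node R N.+2 i) * sin (node R N.+2 i)
    = N.+2%:R / 2 * a 1%N.
Proof.
move=> N0; transitivity (\sum_(1 <= j < N.+1) a j *
    (N.+2%:R / 2 * (j == 1%N)%:R)); last first.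
  rewrite big_ltn // big_nat big1 => [|j /andP[j1 _]].
    by rewrite addr0 mulr1 mulrC.
  have /negbTE-> : j != 1%N by lia.
  by rewrite !mulr0.
transitivity (\sum_(1 <= j < N.+1) \sum_(i < N.+2)
   a j * (sin (j%:R * node R N.+2 i) * sin (1%:R * node R N.+2 i))).
  rewrite exchange_big; apply: eq_bigr => i _ /=.
  by rewrite big_distrl /= mul1r; under eq_bigr do rewrite -mulrA.
rewrite !big_nat; apply: eq_bigr => j jN; rewrite -big_distrr /=; congr (_ * _).
transitivity (\sum_(i < N.+2)
  (2^-1 * cos (j%:R * node R N.+2 i - 1%:R * node R N.+2 i)
    - 2^-1 * cos (j.+1%:R * node R N.+2 i))).
  apply: eq_bigr => i _; rewrite -[j.+1%:R]natr1 [(_ + _) * node _ _ _]mulrDl.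
  by rewrite cosB cosD; field.
rewrite sumrB -!big_distrr /= sum_cos_subr_node; [|lia..].
rewrite sum_cos_node; [|lia..].
have /negbTE-> : j.+1 != N.+2 by lia.
by rewrite /=; field.
Qed.

Lemma sum_sine_poly_cot (R : realType) (N : nat) (a : nat -> R) :
  \sum_(i < N.+2) sine_poly N a (node R N.+2 i)
     * (sin (node R N.+2 i) / (1 - cos (node R N.+2 i)))
    = N.+2%:R * Defs.coef_sum N a.
Proof.
transitivity (\sum_(1 <= j < N.+1) \sum_(i < N.+2)
   a j * (sin (j%:R * node R N.+2 i)
          * (sin (node R N.+2 i) / (1 - cos (node R N.+2 i))))).
  rewrite exchange_big; apply: eq_bigr => i _ /=.
  by rewrite big_distrl /=; under eq_bigr do rewrite -mulrA.
rewrite /Defs.coef_sum big_distrr /= !big_nat; apply: eq_bigr => j jN.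
by rewrite -big_distrr /= sum_sin_cot_node 1?mulrC //; lia.
Qed.

Lemma mulr_natB2pi (R : realType) (j : nat) (t : R) :
  j%:R * (pi *+ 2 - t) = - (j%:R * t) + pi *+ 2 *+ j.
Proof. by rewrite mulrBr [_ * (pi *+ 2)]mulr_natl addrC. Qed.

Lemma sine_polyB2pi (R : realType) (N : nat) (a : nat -> R) (t : R) :
  sine_poly N a (pi *+ 2 - t) = - sine_poly N a t.
Proof.
rewrite /sine_poly -sumrN; apply: eq_bigr => j _; rewrite -mulrN; congr (_ * _).
by rewrite mulr_natB2pi (periodicn (@sinD2pi R)) sinN.
Qed.

(** Both factors are odd about pi, so the sign on [0, pi] carries over to the whole period. *)
Lemma sine_poly_sin_ge0 (R : realType) (N : nat) (a : nat -> R) (t : R) :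
  admissible N a -> 0 <= t <= pi *+ 2 -> 0 <= sine_poly N a t * sin t.
Proof.
move=> [_ a_ge0] /andP[t0 t2]; have [tpi|tpi] := leP t pi.
  by rewrite mulr_ge0 ?a_ge0 ?sin_ge0_pi // t0.
rewrite -mulrNN -sine_polyB2pi -sinB2pi.
have tp : 0 <= pi *+ 2 - t <= pi by rewrite subr_ge0 t2 mulr2n; lra.
by rewrite mulr_ge0 ?a_ge0 ?sin_ge0_pi.
Qed.

(** Equivalently 1 / (4 sin^2 (pi / (2 (N + 2)))). *)
Definition max_coef_sum (R : realType) (N : nat) : R :=
  (2 * (1 - cos (node R N.+2 0)))^-1.

(** The identity for a_1 = 1, divided by 1 - cos t_0, minus the cotangent identity. The gap thus
    becomes a sum of nonnegative terms, which serves both the bound and the equality case. *)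
Lemma max_coef_sum_defect (R : realType) (N : nat) (a : nat -> R) :
  (0 < N)%N -> admissible N a ->
  N.+2%:R * (max_coef_sum R N - Defs.coef_sum N a) =
  \sum_(i < N.+2) sine_poly N a (node R N.+2 i) * sin (node R N.+2 i)
    * ((1 - cos (node R N.+2 0))^-1 - (1 - cos (node R N.+2 i))^-1).
Proof.
move=> N0 [a1 _]; rewrite mulrBr -sum_sine_poly_cot.
under [in RHS]eq_bigr do rewrite mulrBr -[X in _ - X]mulrA.
rewrite sumrB -big_distrl /= sum_sine_poly_sin // a1 mulr1; congr (_ - _).
have h : 1 - cos (node R N.+2 0) != 0 by rewrite subr_eq0 gt_eqF // cos_node_lt1.
by rewrite /max_coef_sum; field.
Qed.

Lemma max_coef_sum_defect_term_ge0 (R : realType) (N i : nat) (a : nat -> R) :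
  admissible N a -> (i < N.+2)%N ->
  0 <= sine_poly N a (node R N.+2 i) * sin (node R N.+2 i)
    * ((1 - cos (node R N.+2 0))^-1 - (1 - cos (node R N.+2 i))^-1).
Proof.
move=> a_adm iN; have /andP[t0 t2] := node_itv R iN.
rewrite mulr_ge0 ?sine_poly_sin_ge0 ?(ltW t0) ?(ltW t2) // subr_ge0.
by rewrite lef_pV2 ?posrE ?subr_gt0 ?cos_node_lt1 // lerD2l lerN2 cos_node_le.
Qed.

Lemma coef_sum_le (R : realType) (N : nat) (a : nat -> R) : (0 < N)%N ->
  admissible N a -> Defs.coef_sum N a <= max_coef_sum R N.
Proof.
move=> N0 a_adm; rewrite -subr_ge0 -(@pmulr_rge0 _ N.+2%:R) ?ltr0n //.
rewrite max_coef_sum_defect // sumr_ge0 // => i _.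
exact: max_coef_sum_defect_term_ge0.
Qed.

Lemma coef_sum_max_node (R : realType) (N i : nat) (a : nat -> R) :
  (0 < N)%N -> admissible N a -> Defs.coef_sum N a = max_coef_sum R N ->
  (0 < i < N.+1)%N ->
  sine_poly N a (node R N.+2 i) * sin (node R N.+2 i) = 0.
Proof.
move=> N0 a_adm a_max iN; have ltiN : (i < N.+2)%N by lia.
have := max_coef_sum_defect N0 a_adm; rewrite a_max subrr mulr0.
move=> /esym sum0.
have /eqP := psumr_eq0P
  (fun j _ => max_coef_sum_defect_term_ge0 a_adm (ltn_ord j)) sum0
  (i := Ordinal ltiN) isT.
(* The weight is strictly positive at these indices, so the other factor must vanish. *)
rewrite mulf_eq0 => /orP[/eqP//|]; rewrite gt_eqF // subr_gt0.
by rewrite ltf_pV2 ?posrE ?subr_gt0 ?cos_node_lt1 // ltrD2l ltrN2 cos_node_lt.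
Qed.

(** * Double zeros at the nodes *)

Lemma is_derive_sine_poly (R : realType) (N : nat) (a : nat -> R) (t : R) :
  is_derive t 1 (sine_poly N a) (sine_deriv N a t).
Proof.
elim: N => [|N IHN].
  have -> : sine_poly 0 a = cst 0.
    by apply/funext => x; rewrite /sine_poly big_geq.
  by rewrite /sine_deriv big_geq //; exact: is_derive_cst.
have -> : sine_poly N.+1 a
    = sine_poly N a \+ (a N.+1 \*: (@sin R \o ( *:%R N.+1%:R))).
  by apply/funext => x; rewrite /sine_poly big_nat_recr.
rewrite /sine_deriv big_nat_recr //= -/(sine_deriv N a t).
apply: is_deriveD; apply: is_deriveZ.
rewrite mulrC; apply: is_derive1_comp.
by apply: is_derive_eq; exact: mulr1.
Qed.

(** The product S sin is nonnegative on both sides of pi, so a zero of S at a node is an interior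
    minimum of it. Its derivative there reduces to sin t S'(t), which gives S'(t) = 0 away from
    pi. *)
Lemma sine_deriv_eq0 (R : realType) (N i : nat) (a : nat -> R) :
  admissible N a -> (i < N.+2)%N -> sin (node R N.+2 i) != 0 ->
  sine_poly N a (node R N.+2 i) = 0 -> sine_deriv N a (node R N.+2 i) = 0.
Proof.
move=> a_adm iN sin0 S0; have := node_itv R iN; set t := node R N.+2 i in sin0 S0 *.
move=> t_itv.
have dg (x : R) : is_derive x 1 (sine_poly N a * @sin R)
    (sine_poly N a x *: cos x + sin x *: sine_deriv N a x).
  exact: (is_deriveM (is_derive_sine_poly _ _ _)).
have g'0 : is_derive t 1 (sine_poly N a * @sin R) 0.
  apply: (@derive1_at_min _ _ 0 (pi *+ 2)).
  - by rewrite mulrn_wge0 ?pi_ge0.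
  - by move=> x _; case: (dg x).
  - by rewrite in_itv.
  - move=> x; rewrite in_itv => /andP[x0 x2]; rewrite /= /GRing.mul /= S0 mul0r.
    by rewrite sine_poly_sin_ge0 // !ltW.
have [_ e1] := dg t; have [_ e2] := g'0; move: e1; rewrite e2 S0 scale0r add0r.
by move=> /esym/eqP; rewrite scaler_eq0 (negbTE sin0) => /eqP.
Qed.

Lemma sine_derivB2pi (R : realType) (N : nat) (a : nat -> R) (t : R) :
  sine_deriv N a (pi *+ 2 - t) = sine_deriv N a t.
Proof.
apply: eq_bigr => j _; congr (_ * (_ * _)).
by rewrite mulr_natB2pi (periodicn (@cosD2pi R)) cosN.
Qed.

(** * Coefficients of a maximizer *)

Lemma node_mid (R : realType) (m : nat) : node R (m.*2.+1) m = pi.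
Proof. by rewrite /node mulrC divfK // pnatr_eq0. Qed.

Lemma sin_node_neq0 (R : realType) (m i : nat) :
  (i < m.*2.+1)%N -> i != m -> sin (node R m.*2.+1 i) != 0.
Proof.
wlog leiM : i / (i < m)%N => [wlog_le|] iM im.
  have [/wlog_le|ltMi] := ltnP i m; first exact.
  rewrite -oppr_eq0 -sinB2pi -node_rev //; apply: wlog_le; lia.
rewrite gt_eqF // sin_gt0_pi //; have /andP[-> _] := node_itv R iM.
rewrite -(node_mid R m) /node ltr_pM2r ?ltr_nat /=; first lia.
by rewrite divr_gt0 ?pi_gt0 ?ltr0n.
Qed.

Lemma sin_node0_gt0 (R : realType) (N : nat) : 0 < sin (node R N.+2 0).
Proof.
rewrite sin_gt0_pi // /node mul1r divr_gt0 ?pi_gt0 ?ltr0n //=.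
by rewrite ltr_pdivrMr ?ltr0n // ltr_pMr ?pi_gt0 // ltr1n.
Qed.

(** Only t_0, its mirror 2 pi - t_0 and pi survive in the inversion formula; pi is a node because N
    + 2 is odd. The mirror pair contributes equally, whence the factors 2, and at pi the sine terms
    vanish. *)
Lemma coef_sum_max_coefE (R : realType) (m k : nat) (a : nat -> R) :
  let N := m.*2.+1 in let t := node R N.+2 0 in
  admissible N a -> Defs.coef_sum N a = max_coef_sum R N -> (0 < k <= N.+2)%N ->
  N.+2%:R ^+ 2 / 2 * (if (k <= N)%N then a k else 0) =
  2 * sine_poly N a t * ((N.+2%:R - k%:R) * sin (k%:R * t))
  + 2 * sine_deriv N a t * cos (k%:R * t) + sine_deriv N a pi * (-1) ^+ k.
Proof.
move=> N t a_adm a_max kN; rewrite hermite_coef //.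
rewrite big_ord_recl big_ord_recr /=.
have mN : (m < N)%N by rewrite /N; lia.
(* Splitting off the first node has shifted the indices by one: [m] here stands for node [m.+1],
   which is pi. *)
rewrite (bigD1 (Ordinal mN)) //= big1 ?addr0 => [|[i iN] /=]; last first.
  rewrite -val_eqE /= /bump /= => im.
  have iN2 : (i.+1 < N.+2)%N by lia.
  have sn0 : sin (node R N.+2 i.+1) != 0.
    rewrite (_ : N.+2 = m.+1.*2.+1) ?sin_node_neq0 //; lia.
  have S0 : sine_poly N a (node R N.+2 i.+1) = 0.
    apply: (mulIf sn0); rewrite mul0r coef_sum_max_node //; lia.
  by rewrite S0 sine_deriv_eq0 // !mul0r mulr0 addr0.
rewrite /bump /= !add1n -/t.
have -> : node R N.+2 m.+1 = pi by exact: (node_mid R m.+1).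
have -> : node R N.+2 N.+1 = pi *+ 2 - t.
  rewrite -node_rev //; congr node; lia.
rewrite sine_polyB2pi sine_derivB2pi sin_natpi cos_natpi.
rewrite mulr_natB2pi (periodicn (@sinD2pi R)) (periodicn (@cosD2pi R)) sinN cosN.
ring.
Qed.

(** The cases k = N + 2, N + 1 and 1, with known left sides 0, 0 and (N + 2)^2 / 2, form a linear
    system for S(t_0), S'(t_0) and S'(pi). *)
Lemma extremal_coefE (R : realType) (m k : nat) (a : nat -> R) :
  let N := m.*2.+1 in let t := node R N.+2 0 in
  admissible N a -> Defs.coef_sum N a = max_coef_sum R N -> (0 < k <= N)%N ->
  a k = (N.+2%:R - k%:R) * sin (k%:R * t) / (N.+2%:R * sin t)
        + (cos (k%:R * t) - (-1) ^+ k) / (N.+2%:R * (1 + cos t)).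
Proof.
move=> N t a_adm a_max kN.
have coefE j := coef_sum_max_coefE (k := j) a_adm a_max.
rewrite -/N -/t /= in coefE.
have M0 : N.+2%:R != 0 :> R by rewrite pnatr_eq0.
have st0 : sin t != 0 by rewrite gt_eqF // sin_node0_gt0.
have ct0 : 1 + cos t != 0.
  apply: contra st0 => /eqP ct; rewrite -sqrf_eq0 sin2cos2.
  by have -> : cos t = -1 by [lra]; rewrite sqrrN expr1n subrr.
have Mt : N.+2%:R * t = pi by rewrite /t /node mul1r mulrC divfK.
have M1t : N.+1%:R * t = pi - t by rewrite -Mt -[N.+2%:R]natr1; ring.
have sgN : (-1) ^+ N = -1 :> R by rewrite -signr_odd /N /= odd_double.
have eM := coefE N.+2; have eM1 := coefE N.+1; have e1 := coefE 1%N.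
have ltNM : (N.+2 <= N)%N = false by lia.
have ltNM1 : (N.+1 <= N)%N = false by lia.
rewrite ltNM Mt cospi sinpi [_ ^+ N.+2]exprS [_ ^+ N.+1]exprS sgN in eM.
rewrite ltNM1 M1t sinB cosB cospi sinpi [_ ^+ N.+1]exprS sgN in eM1.
rewrite /= a_adm.1 mul1r mulr1 expr1 in e1.
have {}eM := eM (leqnn _); have {}eM1 := eM1 (leqnSn _); have {}e1 := e1 isT.
have /andP[k0 kN'] := kN; have kN2 : (0 < k <= N.+2)%N by lia.
have := coefE k kN2; rewrite kN' => ek; rewrite -[N.+1%:R]/(N.+1%:R) in eM1.
have NM : N.+1%:R = N.+2%:R - 1 :> R by rewrite -[N.+2%:R]natr1 addrK.
move: (sine_poly N a t) (sine_deriv N a t) (sine_deriv N a pi) eM eM1 e1 ek.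
move: N.+2%:R M0 NM => M M0 ->.
move: (sin (k%:R * t)) (cos (k%:R * t)) ((-1) ^+ k) => s c e.
move: (sin t) (cos t) st0 ct0 => st ct st0 ct0 S S' S'pi eM eM1 e1 ek.
(* The case k = N + 2 gives [r_q], k = N + 1 gives [p_q], and the normalization at k = 1 gives
   [q_E]. *)
have r_q : S'pi = - (2 * S') by lra.
have p_q : 2 * S * st = 2 * S' * (1 + ct) by move: eM1; rewrite r_q; lra.
have q_E : 2 * S' * (1 + ct) = M / 2.
  have : M ^+ 2 / 2 = M * (2 * S' * (1 + ct)).
    move: e1; rewrite r_q => ->.
    by rewrite mulrCA p_q; ring.
  by move=> h; apply: (mulfI M0); rewrite -h; field.
have pE : 2 * S = M / 2 / st by rewrite -q_E -p_q mulfK.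
have qE : 2 * S' = M / 2 / (1 + ct) by rewrite -q_E mulfK.
have M20 : M ^+ 2 / 2 != 0 by rewrite mulf_neq0 ?invr_eq0 ?pnatr_eq0 ?expf_neq0.
apply: (mulfI M20); rewrite ek r_q pE qE; field.
by rewrite ct0 st0 M0.
Qed.

(** * Existence of a maximizer *)

Lemma size_chebyshevU (R : realType) (j : nat) : size (chebyshevU R j) = j.+1.
Proof.
have two0 : 2 != 0 :> R by rewrite pnatr_eq0.
suff [] : size (chebyshevU R j) = j.+1 /\ size (chebyshevU R j.+1) = j.+2 by [].
elim: j => [|j [IH1 IH2]].
  by rewrite /= size_poly1 size_scale ?size_polyX.
split=> //; rewrite chebyshevU_rec size_polyDl -scalerAl size_scale //.
  by rewrite mulrC size_mulX ?IH2 // -size_poly_eq0 IH2.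
by rewrite size_polyN mulrC size_mulX ?IH1 ?IH2 // -size_poly_eq0 IH2.
Qed.

(** Since U_j has degree exactly j, subtracting a multiple of the top one lowers the size. The shift
    [j - 1] matches sin jt = U_(j-1)(cos t) sin t. *)
Lemma chebyshevU_span (R : realType) (N : nat) (p : {poly R}) :
  (size p <= N)%N ->
  exists b : nat -> R, p = \sum_(1 <= j < N.+1) b j *: chebyshevU R (j - 1).
Proof.
elim: N p => [|N IHN] p pN.
  by exists (fun=> 0); rewrite big_geq //; apply/eqP; rewrite -size_poly_leq0.
have lc0 : lead_coef (chebyshevU R N) != 0.
  by rewrite lead_coef_eq0 -size_poly_eq0 size_chebyshevU.
pose c := p`_N / lead_coef (chebyshevU R N).
have /IHN[b bE] : (size (p - c *: chebyshevU R N)%R <= N)%N.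
  apply/leq_sizeP => j; rewrite leq_eqVlt coefB coefZ => /predU1P[<-|ltNj].
    have lcE : (chebyshevU R N)`_N = lead_coef (chebyshevU R N).
      by rewrite lead_coefE size_chebyshevU.
    by rewrite lcE divfK // subrr.
  by rewrite !nth_default ?mulr0 ?subrr // ?size_chebyshevU // (leq_trans pN).
exists (fun j => if j == N.+1 then c else b j).
rewrite big_nat_recr //= eqxx subSS subn0 -[LHS](subrK (c *: chebyshevU R N)) bE.
congr (_ + _); rewrite !big_nat; apply: eq_bigr => j jN.
by have /negbTE-> : j != N.+1 by lia.
Qed.

Lemma sine_poly_chebyshevU (R : realType) (N : nat) (b : nat -> R) (t : R) :
  sine_poly N b t
    = (\sum_(1 <= j < N.+1) b j *: chebyshevU R (j - 1)).[cos t] * sin t.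
Proof.
rewrite horner_sum big_distrl /= /sine_poly !big_nat; apply: eq_bigr => j jN.
rewrite hornerZ -mulrA chebyshevU_cosM; congr (_ * sin (_%:R * _)); lia.
Qed.

(** With D vanishing at cos t_1, ..., cos t_m, the function D(cos t)^2 sin t has the required sign
    and double zeros, and D^2 has degree 2m = N - 1, so it is a sine polynomial of degree at most
    N. *)
Lemma exists_coef_sum_max (R : realType) (m : nat) :
  exists a : nat -> R,
    admissible m.*2.+1 a /\ Defs.coef_sum m.*2.+1 a = max_coef_sum R m.*2.+1.
Proof.
set N := m.*2.+1; pose t i := node R N.+2 i.
pose D : {poly R} := \prod_(i <- iota 1 m) ('X - (cos (t i))%:P).
have [b DbE] : exists b : nat -> R,
    D ^+ 2 = \sum_(1 <= j < N.+1) b j *: chebyshevU R (j - 1).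
  apply: chebyshevU_span; apply: leq_trans (size_exp_leq _ _) _.
  by rewrite size_prod_XsubC size_iota /N; lia.
have Sb u : sine_poly N b u = D.[cos u] ^+ 2 * sin u.
  by rewrite sine_poly_chebyshevU -DbE horner_exp.
have Sb_sin u : sine_poly N b u * sin u = D.[cos u] ^+ 2 * sin u ^+ 2.
  by rewrite Sb -mulrA.
have D0 : D.[cos (t 0%N)] != 0.
  rewrite horner_prod prodf_seq_neq0; apply/allP => i; rewrite mem_iota => im /=.
  rewrite hornerXsubC subr_eq0 gt_eqF // cos_node_lt //; lia.
(* Normalization needs b_1 > 0: up to a positive factor b_1 is the node sum of D^2 sin^2, whose term
   at t_0 is positive. *)
have b1_gt0 : 0 < b 1%N.
  rewrite -(@pmulr_rgt0 _ (N.+2%:R / 2)) ?divr_gt0 ?ltr0n //.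
  rewrite -sum_sine_poly_sin // (bigD1 ord0) //= ltr_wpDr //.
    by apply: sumr_ge0 => i _; rewrite Sb_sin mulr_ge0 ?sqr_ge0.
  rewrite Sb_sin mulr_gt0 // lt0r sqrf_eq0 sqr_ge0 andbT //.
  by rewrite gt_eqF // sin_node0_gt0.
pose a j := b j / b 1%N.
have Sa u : sine_poly N a u = sine_poly N b u / b 1%N.
  by rewrite /sine_poly big_distrl /=; apply: eq_bigr => j _; rewrite mulrAC.
have a_adm : admissible N a.
  split=> [|u upi]; first by rewrite /a divff // gt_eqF.
  by rewrite Sa Sb divr_ge0 ?(ltW b1_gt0) // mulr_ge0 ?sqr_ge0 ?sin_ge0_pi.
exists a; split=> //; apply/esym/eqP; rewrite -subr_eq0.
(* The bound is attained once every term of the defect vanishes: through the weight at t_0 and its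
   mirror, through sine at pi, and through D elsewhere. *)
rewrite -(inj_eq (mulfI (_ : N.+2%:R != 0))) ?pnatr_eq0 // mulr0.
rewrite max_coef_sum_defect // big1 // => -[i iN] _ /=.
have root_t j : (0 < j <= m)%N -> D.[cos (t j)] = 0.
  move=> jm; apply/eqP; rewrite horner_prod prodf_seq_eq0; apply/hasP.
  exists j; first by rewrite mem_iota; lia.
  by rewrite hornerXsubC subrr eqxx.
have [->|i0] := eqVneq i 0%N; first by rewrite subrr mulr0.
have [eiN|iN1] := eqVneq i N.+1.
  have -> : i = (N.+2 - 1)%N by lia.
  by rewrite node_rev // cosB2pi subrr mulr0.
have [eim|im] := eqVneq i m.+1.
  have -> : node R N.+2 i = pi by rewrite eim; exact: (node_mid R m.+1).
  by rewrite sinpi mulr0 mul0r.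
suff Di0 : D.[cos (t i)] = 0.
  by rewrite Sa Sb Di0 expr0n !mul0r.
have [leim|ltmi] := leqP i m; first by apply: root_t; lia.
have -> : cos (t i) = cos (t (N.+2 - i.+1)%N) by rewrite /t node_rev ?cosB2pi.
by apply: root_t; rewrite /N; lia.
Qed.

(** * Chebyshev form of the coefficients *)

(** This is the derivative of U_n(cos u) sin u = sin (n+1)u, multiplied by sin u. Induction along
    the three-term recurrence yields it algebraically. *)
Lemma deriv_chebyshevU_cosM (R : realType) (n : nat) (u : R) :
  (chebyshevU R n)^`().[cos u] * sin u ^+ 3
    = sin (n.+1%:R * u) * cos u - n.+1%:R * cos (n.+1%:R * u) * sin u.
Proof.
suff: (chebyshevU R n)^`().[cos u] * sin u ^+ 3
      = sin (n.+1%:R * u) * cos u - n.+1%:R * cos (n.+1%:R * u) * sin u /\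
    (chebyshevU R n.+1)^`().[cos u] * sin u ^+ 3
      = sin (n.+2%:R * u) * cos u - n.+2%:R * cos (n.+2%:R * u) * sin u by case.
elim: n => [|n [IH1 IH2]].
  rewrite /= -[1](polyC1 R) derivC hornerC mul0r !mul1r; split; first by ring.
  rewrite derivZ derivX hornerZ hornerC [2 * u]mulr_natl mulr2n sinD cosD.
  by have := cos2Dsin2 u; move: (sin u) (cos u) => s c h; ring: h.
split=> //; rewrite chebyshevU_rec derivB derivM derivZ derivX.
rewrite !(hornerD, hornerN, hornerM, hornerZ, hornerX, hornerC).
transitivity (2 * ((chebyshevU R n.+1).[cos u] * sin u) * sin u ^+ 2
    + 2 * cos u * ((chebyshevU R n.+1)^`().[cos u] * sin u ^+ 3)
    - (chebyshevU R n)^`().[cos u] * sin u ^+ 3); first by ring.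
rewrite IH1 IH2 chebyshevU_cosM.
have -> : n.+1%:R * u = n.+2%:R * u - u by rewrite -[n.+2%:R]natr1; ring.
have -> : n.+3%:R * u = n.+2%:R * u + u by rewrite -[n.+3%:R]natr1; ring.
rewrite sinB cosB sinD cosD -[n.+3%:R]natr1 -[n.+2%:R]natr1; ring.
Qed.

(** At u = pi/2 - t/2 one has x = cos u and t = pi - 2u, so functions of kt become double-angle
    functions of ku, from which the factor sin ku of U_(k-1) splits off. *)
Lemma extremal_coef_chebyshevU (R : realType) (m k : nat) :
  let N := m.*2.+1 in let t := node R N.+2 0 in
  let x : R := sin (pi / (2 * (N + 2))%:R) in
  (1 <= k <= N)%N ->
  (N.+2%:R - k%:R) * sin (k%:R * t) / (N.+2%:R * sin t)
    + (cos (k%:R * t) - (-1) ^+ k) / (N.+2%:R * (1 + cos t))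
  = (-1) ^+ (k - 1) / (chebyshevU R N)^`().[x]
              * (chebyshevU R (N - k + 1))^`().[x]
              * (chebyshevU R (k - 1)).[x].
Proof.
move=> N t x kN; pose u : R := pi / 2 - t / 2.
have M0 : N.+2%:R != 0 :> R by rewrite pnatr_eq0.
have Mt : N.+2%:R * t = pi by rewrite /t /node mul1r mulrC divfK.
have t_gt0 : 0 < t by rewrite /t; case/andP: (@node_itv R N.+2 0 isT).
have t_lt : t < pi.
  by rewrite -Mt ltr_pMl // ltr1n.
have xE : x = cos u.
  rewrite /u cosB cos_pihalf sin_pihalf mul0r add0r mul1r /x; congr sin.
  rewrite /t /node mul1r natrM addn2.
  by move: N.+2%:R M0 => M M0; field.
have s_gt0 : 0 < sin u.
  by rewrite sin_gt0_pi // /u; apply/andP; split; lra.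
have c_gt0 : 0 < cos u.
  by rewrite cos_gt0_pihalf // /u; apply/andP; split; lra.
have tE : t = pi - (u + u) by rewrite /u; field.
(* Oddness of N makes (N + 2) u a multiple of pi, so the index N + 2 - k of the derivative reflects
   to k at the cost of a sign. *)
have Mu : N.+2%:R * u = m.+1%:R * pi.
  rewrite /u mulrBr mulrA [N.+2%:R * (t / 2)]mulrA Mt.
  by rewrite /N -[m.*2.+3]addn3 natrD -muln2 natrM -[m.+1%:R]natr1; field.
have ktE : k%:R * t = - (k%:R * u + k%:R * u) + pi *+ k.
  by rewrite [in LHS]tE mulrBr [k%:R * pi]mulr_natl mulrDr addrC.
have sME j : (j <= N.+2)%N ->
    sin ((N.+2 - j)%:R * u) = - (-1) ^+ m.+1 * sin (j%:R * u) /\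
    cos ((N.+2 - j)%:R * u) = (-1) ^+ m.+1 * cos (j%:R * u).
  move=> jN; rewrite natrB // mulrBl Mu sinB cosB sin_natpi cos_natpi.
  by split; ring.
have UkE : (chebyshevU R (k - 1)).[x] = sin (k%:R * u) / sin u.
  rewrite xE -[LHS](mulfK (lt0r_neq0 s_gt0)) chebyshevU_cosM.
  by rewrite (_ : (k - 1).+1 = k) //; lia.
have U'E j : (0 < j <= N)%N -> (chebyshevU R (N - j + 1))^`().[x]
    = - (-1) ^+ m.+1 * (sin (j%:R * u) * cos u
        + (N.+2%:R - j%:R) * cos (j%:R * u) * sin u) / sin u ^+ 3.
  move=> jN; have s30 : sin u ^+ 3 != 0 by rewrite expf_neq0 ?lt0r_neq0.
  rewrite xE -[LHS](mulfK s30) deriv_chebyshevU_cosM; congr (_ / _).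
  have -> : (N - j + 1).+1 = (N.+2 - j)%N by lia.
  have [-> ->] : _ /\ _ := sME j ltac:(lia).
  rewrite natrB; last lia.
  by ring.
(* The case j = 1 is the denominator U'_N(x); the sign (-1)^(m+1) then cancels in the quotient. *)
have := U'E 1%N isT; rewrite subnK // => ->; rewrite U'E // UkE.
rewrite ktE (alternatingn (@sinDpi R)) (alternatingn (@cosDpi R)) sinN cosN.
rewrite sinD cosD tE sinB cosB sinpi cospi sinD cosD mul1r.
have -> : (-1) ^+ k = - (-1) ^+ (k - 1) :> R.
  by rewrite -[in LHS](@subnK 1 k) ?addn1 ?exprS ?mulN1r //; lia.
have s2 := sin2cos2 (k%:R * u); have s2u := sin2cos2 u.
have e0 : (-1) ^+ m.+1 != 0 :> R by rewrite signr_eq0.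
move: (sin u) (cos u) (lt0r_neq0 s_gt0) (lt0r_neq0 c_gt0) s2u => s c s0 c0 s2u.
move: (sin (k%:R * u)) (cos (k%:R * u)) s2 => S C s2.
have -> : 0 * (c * c - s * s) - -1 * (s * c + c * s) = 2 * (s * c) by ring.
have -> : 1 + (-1 * (c * c - s * s) + 0 * (s * c + c * s)) = 2 * s ^+ 2.
  by have -> : c * c = 1 - s ^+ 2 by [rewrite s2u; ring]; ring.
have -> : C * C - S * S = 1 - 2 * S ^+ 2.
  by have -> : C * C = 1 - S ^+ 2 by [rewrite s2; ring]; ring.
have -> : s * c + (N.+2%:R - 1) * c * s = N.+2%:R * (s * c) by ring.
move: ((-1) ^+ m.+1) ((-1) ^+ (k - 1)) N.+2%:R M0 e0 => e sk M M0 e0.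
by field; rewrite M0 e0 s0 c0.
Qed.

Theorem theorem3 (R : realType) (N : nat) (N_odd : odd N) :
  (exists! p : {poly R}, extremal_polynomial N p) /\
  (forall p : {poly R}, extremal_polynomial N p ->
     forall k : nat, (1 <= k <= N)%N ->
       let x : R := sin (pi / (2 * (N + 2))%:R) in
       p`_k = (-1) ^+ (k - 1) / (chebyshevU R N)^`().[x]
              * (chebyshevU R (N - k + 1))^`().[x]
              * (chebyshevU R (k - 1)).[x]).
Proof.
have [m ->] : exists m, N = m.*2.+1.
  by exists N./2; rewrite -[LHS]odd_double_half N_odd.
have [a [a_adm a_sum]] := exists_coef_sum_max R m.
(* Comparison with [a] forces every maximizer to reach the bound, so the explicit coefficient
   formula applies to it and yields uniqueness as well. *)
have max_sum b : attains_max m.*2.+1 b ->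
    admissible m.*2.+1 b /\ Defs.coef_sum m.*2.+1 b = max_coef_sum R m.*2.+1.
  move=> [b_adm b_max]; split=> //; apply/eqP.
  by rewrite eq_le coef_sum_le // -a_sum b_max.
split.
  exists (\sum_(1 <= j < m.*2.+2) a j *: 'X^j); split.
    exists a; split=> //; split=> // b b_adm.
    by rewrite a_sum coef_sum_le.
  move=> _ [b [/max_sum[b_adm b_sum] ->]]; rewrite !big_nat.
  apply: eq_bigr => j jN.
  by rewrite (extremal_coefE a_adm a_sum jN) (extremal_coefE b_adm b_sum jN).
move=> _ [b [/max_sum[b_adm b_sum] ->]] k kN x.
rewrite -(extremal_coef_chebyshevU R kN) -(extremal_coefE b_adm b_sum kN).
by rewrite coef_sumMXn big_nat1_eq ltnS kN.
Qed.
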